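(* Let $\mathcal{N}$ be a sum-network over a finite field $F$ which has only one source or only one terminal. Then both the capacity and the linear coding capacity of $\mathcal{N}$ equal $\min_{i,j}\ \text{min-cut}(s_i - t_j)$, the minimum over all source-terminal pairs.
   Context: A sum-network is a finite directed acyclic multigraph $\mathcal{G}=(V,E)$ with distinguished source nodes $s_1,\dots,s_m$ and terminal nodes $t_1,\dots,t_n$; each edge carries one symbol of the alphabet per use. A $(k,l)$ fractional network code over alphabet $A$ (here $A=F$) consists of: for each source $s_i$, which holds a message $X_i\in A^k$, functions $f_e: A^k\to A^l$ for each outgoing edge $e$ of $s_i$; for each edge $e$ whose tail $v$ is not a source, a function $f_e: A^{l|In(v)|}\to A^l$ of the vectors on the incoming edges of $v$; and for each terminal $t$, a decoding function $g_t: A^{l|In(t)|}\to A^k$. It is a solution if every terminal outputs $X_1+\cdots+X_m$ (componentwise) for all messages. Rate $k/l$ is achievable if a $(k,l)$ fractional solution exists; the capacity is the supremum of achievable rates. A code is linear if all edge and decoding functions are $F$-linear; the linear coding capacity is the supremum of rates of linear $(k,l)$ fractional solutions. $\text{min-cut}(s_i-t_j)$ is the minimum number of edges whose removal disconnects $t_j$ from $s_i$.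
   Formalization: Assumes that sources have no incoming edges and that no source is a terminal; otherwise the claim fails (s1→s2→t has min-cuts 1 but capacity 0, since edges leaving a source depend only on its message) or a min-cut is undefined. *)

(* Defs.v *)
From HB Require Import structures.
From mathcomp Require Import all_boot all_order all_algebra all_field.
Set Implicit Arguments. Unset Strict Implicit. Unset Printing Implicit Defensive.
Import Order.TTheory GRing.Theory Num.Theory.
Local Open Scope ring_scope.

(* A directed multigraph: vertices V, edges E, each edge e goes from tl e to hd e. *)

Definition edge_rel (V E : finType) (tl hd : E -> V) (C : {set E}) : rel V :=
  fun u v => [exists e, [&& e \notin C, tl e == u & hd e == v]].

Definition acyclic (V E : finType) (tl hd : E -> V) : Prop :=
  forall e : E, ~~ connect (edge_rel tl hd set0) (hd e) (tl e).

Definition sum_network (V E : finType) (tl hd : E -> V) (m n : nat)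
    (s : 'I_m -> V) (t : 'I_n -> V) : Prop :=
  [/\ acyclic tl hd, (0 < m)%N & (0 < n)%N] /\
  [/\ injective s, injective t,
      (forall i j, s i <> t j) & (forall i e, hd e <> s i)].

Definition separates (V E : finType) (tl hd : E -> V) (C : {set E}) (u v : V) : bool :=
  ~~ connect (edge_rel tl hd C) u v.

Definition mincut (V E : finType) (tl hd : E -> V) (u v : V) : nat :=
  \big[minn/#|E|]_(C : {set E} | separates tl hd C u v) #|C|.

Definition min_mincut (V E : finType) (tl hd : E -> V) (m n : nat)
    (s : 'I_m -> V) (t : 'I_n -> V) : nat :=
  \big[minn/#|E|]_(p : 'I_m * 'I_n) mincut tl hd (s p.1) (t p.2).

Definition local_at (V E : finType) (hd : E -> V) (F : fieldType) (l : nat) (T : Type)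
    (v : V) (g : (E -> 'rV[F]_l) -> T) : Prop :=
  forall y y' : E -> 'rV[F]_l, (forall e, hd e = v -> y e = y' e) -> g y = g y'.

(* y is the vector carried by each edge under messages X:
   fsrc e is the encoding of an edge e out of a source,
   fint e the function at an edge whose tail is not a source *)
Definition consistent (V E : finType) (tl : E -> V) (m : nat) (s : 'I_m -> V)
    (F : fieldType) (k l : nat)
    (fsrc : E -> 'rV[F]_k -> 'rV[F]_l) (fint : E -> (E -> 'rV[F]_l) -> 'rV[F]_l)
    (X : 'I_m -> 'rV[F]_k) (y : E -> 'rV[F]_l) : Prop :=
  (forall i e, tl e = s i -> y e = fsrc e (X i)) /\
  (forall e, (forall i, tl e <> s i) -> y e = fint e y).

Definition is_solution (V E : finType) (tl hd : E -> V) (m n : nat)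
    (s : 'I_m -> V) (t : 'I_n -> V) (F : fieldType) (k l : nat)
    (fsrc : E -> 'rV[F]_k -> 'rV[F]_l) (fint : E -> (E -> 'rV[F]_l) -> 'rV[F]_l)
    (dec : 'I_n -> (E -> 'rV[F]_l) -> 'rV[F]_k) : Prop :=
  [/\ (forall e, local_at hd (tl e) (fint e)),
      (forall j, local_at hd (t j) (dec j)) &
      (forall X y, consistent tl s fsrc fint X y ->
         forall j, dec j y = \sum_(i < m) X i)].

Definition lin_map (F : fieldType) (k l : nat) (f : 'rV[F]_k -> 'rV[F]_l) : Prop :=
  forall (a : F) x x', f (a *: x + x') = a *: f x + f x'.

Definition lin_fun (E : Type) (F : fieldType) (l p : nat)
    (g : (E -> 'rV[F]_l) -> 'rV[F]_p) : Prop :=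
  forall (a : F) (y y' : E -> 'rV[F]_l),
    g (fun e => a *: y e + y' e) = a *: g y + g y'.

Definition achievable (V E : finType) (tl hd : E -> V) (m n : nat)
    (s : 'I_m -> V) (t : 'I_n -> V) (F : fieldType) (k l : nat) : Prop :=
  (0 < l)%N /\ exists fsrc fint dec, @is_solution V E tl hd m n s t F k l fsrc fint dec.

Definition lin_achievable (V E : finType) (tl hd : E -> V) (m n : nat)
    (s : 'I_m -> V) (t : 'I_n -> V) (F : fieldType) (k l : nat) : Prop :=
  (0 < l)%N /\ exists fsrc fint dec,
    [/\ @is_solution V E tl hd m n s t F k l fsrc fint dec,
        (forall e, lin_map (fsrc e)), (forall e, lin_fun (fint e))
      & (forall j, lin_fun (dec j))].

Definition is_capacity (P : nat -> nat -> Prop) (c : rat) : Prop :=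
  (forall k l, P k l -> (k%:R / l%:R : rat) <= c) /\
  (forall r : rat, r < c -> exists k l, P k l /\ r < k%:R / l%:R).

(* Main.v *)
Require Import Defs.
From HB Require Import structures.
From mathcomp Require Import all_boot all_order all_algebra all_field.

Set Implicit Arguments. Unset Strict Implicit. Unset Printing Implicit Defensive.
Import Order.TTheory GRing.Theory Num.Theory.

(** Upper bound: with all messages but X_i set to 0, the symbols on a cut between
    s_i and t_j determine those entering t_j, so X_i |-> (symbols on the cut) is
    injective and k <= l * |C|.

    Achievability with a single source r uses random linear codes, without
    max-flow min-cut.  Let q = |F| and fix a message x <> 0.  If U is the set of
    vertices that receive a nonzero symbol, together with r, then all edges
    leaving U carry 0, while each edge with tail in U carries a uniform symbol.
    Hence at most a fraction q ^ (- l * |cut of U|) of all codes has active set U.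
    Every U that misses a terminal defines a cut of size at least h, the smallest
    min-cut, so the union bound over x and U leaves a good code as soon as
    q ^ k * 2 ^ |V| < q ^ (l * h), and the rates k / l approach h.  A single
    terminal is handled by transposing a code for the reversed network. *)

(** * Minima, unions, acyclic graphs and their reversal *)

Lemma bigminn_leq (I : finType) (P : pred I) (f : I -> nat) (d : nat) (j : I) :
  P j -> \big[minn/d]_(i | P i) f i <= f j.
Proof.
move=> Pj; rewrite unlock /reducebig.
have : j \in index_enum I by rewrite mem_index_enum.
elim: (index_enum I) => //= i r IHr; rewrite inE => /predU1P[<- | /IHr le_r].
  by rewrite Pj geq_minl.
by case: (P i) => //; apply: leq_trans (geq_minr _ _) le_r.
Qed.

Lemma card_bigcup_leq (I T : finType) (P : pred I) (A : I -> {set T}) :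
  #|\bigcup_(i | P i) A i| <= \sum_(i | P i) #|A i|.
Proof.
apply: (big_rec2 (fun (B : {set T}) c => #|B| <= c)) => [|i c B _ leBc].
  by rewrite cards0.
by apply: leq_trans (leq_card_setU _ _) _; rewrite leq_add2l.
Qed.

(** The rank counts the vertices from which v can be reached: along an edge this set grows, and the
    head is new since no path leads from it back to the tail. *)
Lemma acyclic_rank (V E : finType) (tl hd : E -> V) :
  acyclic tl hd -> exists rk : V -> nat, forall e, rk (tl e) < rk (hd e).
Proof.
move=> acy; pose R := edge_rel tl hd set0.
exists (fun v => #|[set w | connect R w v]|) => e.
apply: proper_card; apply/properP; split.
  apply/subsetP=> w; rewrite !inE => /connect_trans; apply.
  by apply/connect1/existsP; exists e; rewrite inE !eqxx.
by exists (hd e); rewrite inE ?connect0 // acy.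
Qed.

(* Iterating a local update map stabilises on the edges leaving vertices of
   rank below the number of iterations. *)
Lemma acyclic_fixpoint (V E : finType) (tl hd : E -> V) (T : Type) (y0 : E -> T) :
  acyclic tl hd ->
  exists N, forall upd : (E -> T) -> E -> T,
    (forall e y y', (forall e', hd e' = tl e -> y e' = y' e') ->
       upd y e = upd y' e) ->
    forall e, iter N upd y0 e = upd (iter N upd y0) e.
Proof.
move=> /acyclic_rank[rk rkP]; exists (\max_v rk v).+1 => upd upd_local.
have stable N e : rk (tl e) < N -> iter N upd y0 e = iter N.+1 upd y0 e.
  elim: N e => // N IHN e lt_eN; rewrite !iterS.
  apply: upd_local => e' e'e; apply: IHN; rewrite -ltnS.
  by apply: leq_trans lt_eN; rewrite ltnS -e'e.
by move=> e; apply: stable; rewrite ltnS (leq_bigmax (F := rk)).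
Qed.

Lemma edge_rel_rev (V E : finType) (tl hd : E -> V) (C : {set E}) (u v : V) :
  edge_rel hd tl C u v = edge_rel tl hd C v u.
Proof. by apply: eq_existsb => e; rewrite [(tl e == v) && _]andbC. Qed.

Lemma connect_edge_rel_rev (V E : finType) (tl hd : E -> V) (C : {set E}) (u v : V) :
  connect (edge_rel hd tl C) u v = connect (edge_rel tl hd C) v u.
Proof.
rewrite -[RHS](connect_rev (edge_rel tl hd C)) /=.
by apply: eq_connect => x y; rewrite /= edge_rel_rev.
Qed.

Lemma acyclic_rev (V E : finType) (tl hd : E -> V) :
  acyclic tl hd -> acyclic hd tl.
Proof. by move=> acy e; rewrite connect_edge_rel_rev. Qed.

Lemma mincut_rev (V E : finType) (tl hd : E -> V) (u v : V) :
  mincut hd tl u v = mincut tl hd v u.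
Proof. by apply: eq_bigl => C; rewrite /separates connect_edge_rel_rev. Qed.

(** * Upper bound *)

(** Induction on the rank of the head. If an edge outside C has a head separated from [s i], its
    tail is separated too; so the tail is another source, with the same message, or a vertex whose
    incoming edges already agree. *)
Lemma cut_determines_terminal (V E : finType) (tl hd : E -> V) (m : nat)
    (s : 'I_m -> V) (F : fieldType) (k l : nat)
    (fsrc : E -> 'rV[F]_k -> 'rV[F]_l) (fint : E -> (E -> 'rV[F]_l) -> 'rV[F]_l)
    (i : 'I_m) (v : V) (C : {set E}) (X X' : 'I_m -> 'rV[F]_k)
    (y y' : E -> 'rV[F]_l) :
  acyclic tl hd -> (forall e, local_at hd (tl e) (fint e)) ->
  separates tl hd C (s i) v ->
  (forall i', i' != i -> X i' = X' i') ->
  consistent tl s fsrc fint X y -> consistent tl s fsrc fint X' y' ->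
  (forall e, e \in C -> y e = y' e) ->
  forall e, hd e = v -> y e = y' e.
Proof.
move=> /acyclic_rank[rk rkP] fint_local sepC eqX [ysrc yint] [ysrc' yint'] eqC.
have agree N e : rk (hd e) < N -> separates tl hd C (s i) (hd e) -> y e = y' e.
  elim: N e => // N IHN e lt_eN sep_e.
  have [/eqC // | eNC] := boolP (e \in C).
  have sep_tl : separates tl hd C (s i) (tl e).
    apply: contra sep_e => /connect_trans; apply; apply/connect1/existsP.
    by exists e; rewrite eNC !eqxx.
  have [/existsP[i' /eqP tl_i'] | /existsPn tlNs] := boolP [exists i', tl e == s i'].
    rewrite (ysrc _ _ tl_i') (ysrc' _ _ tl_i') eqX //.
    by apply: contraTneq sep_tl => <-; rewrite tl_i' /separates connect0.
  rewrite yint ?yint' => [|i'|i']; try exact/eqP.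
  apply: fint_local => e' e'e; apply: IHN; last by rewrite /separates e'e.
  by rewrite -ltnS; apply: leq_trans lt_eN; rewrite ltnS e'e.
by move=> e hd_e; rewrite -hd_e in sepC; exact: agree (ltnSn _) sepC.
Qed.

Lemma achievable_cut (F : finFieldType) (V E : finType) (tl hd : E -> V)
    (m n : nat) (s : 'I_m -> V) (t : 'I_n -> V) (k l : nat) (i : 'I_m) (j : 'I_n)
    (C : {set E}) :
  sum_network tl hd s t -> achievable tl hd s t F k l ->
  separates tl hd C (s i) (t j) -> k <= l * #|C|.
Proof.
case=> -[acy _ _] [s_inj _ _ _] [_ [fsrc [fint [dec [fintL decL decP]]]]] sepC.
(* The decoding identity speaks only of consistent edge vectors, so one is built for each X as a
   fixpoint of the encoding. *)
pose upd X y e : 'rV[F]_l :=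
  if [pick i' | tl e == s i'] is Some i' then fsrc e (X i') else fint e y.
have [N NP] := acyclic_fixpoint (fun=> 0%R : 'rV[F]_l) acy.
pose sol X := iter N (upd X) (fun=> 0%R).
have solP X : consistent tl s fsrc fint X (sol X).
  have solE e : sol X e = upd X (sol X) e.
    by apply: NP => {}e y y' eqy; rewrite /upd; case: pickP => // _; apply: fintL.
  split=> [i' e tl_e | e tlNs]; rewrite solE /upd; case: pickP => [i'' /eqP | ].
  - by rewrite tl_e => /s_inj ->.
  - by move/(_ i'); rewrite tl_e eqxx.
  - by move/tlNs.
  - by [].
pose msg x i' : 'rV[F]_k := if i' == i then x else 0%R.
have sum_msg x : (\sum_(i' < m) msg x i' = x)%R.
  by rewrite (bigD1 i) //= /msg eqxx big1 ?addr0 // => i' /negPf ->.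
pose trace x : {ffun 'I_#|C| -> 'rV[F]_l} := [ffun a => sol (msg x) (enum_val a)].
have trace_inj : injective trace.
  move=> x x' eq_tr; rewrite -[x]sum_msg -[x']sum_msg.
  rewrite -(decP _ _ (solP (msg x)) j) -(decP _ _ (solP (msg x')) j).
  apply: decL; apply: (cut_determines_terminal acy fintL sepC _ (solP _) (solP _)).
    by move=> i' /negPf i'i; rewrite /msg i'i.
  move=> e eC; have /ffunP/(_ (enum_rank_in eC e)) := eq_tr.
  by rewrite !ffunE enum_rankK_in.
have := leq_card trace trace_inj.
rewrite card_ffun !card_mx card_ord !mul1n -expnM leq_exp2l //.
exact: finNzRing_gt1.
Qed.

Lemma achievable_min_mincut (F : finFieldType) (V E : finType) (tl hd : E -> V)
    (m n : nat) (s : 'I_m -> V) (t : 'I_n -> V) (k l : nat) :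
  sum_network tl hd s t -> achievable tl hd s t F k l ->
  k <= l * min_mincut tl hd s t.
Proof.
move=> net ach; have [[_ m_gt0 n_gt0] [_ _ sNt _]] := net.
have minP a b : k <= l * a -> k <= l * b -> k <= l * minn a b.
  by rewrite /minn; case: ifP.
(* Both minima have default value [#|E|], the size of the cut made of all edges. *)
have fullP : k <= l * #|E|.
  rewrite -cardsT; apply: (achievable_cut (i := Ordinal m_gt0) (j := Ordinal n_gt0) net ach).
  apply/connectP => -[[|v p] /= ]; first by move=> _ /esym; apply: sNt.
  by case/andP=> /existsP[e]; rewrite inE.
apply: (big_ind (fun c => k <= l * c)) => // -[i j] _.
apply: (big_ind (fun c => k <= l * c)) => // C.
exact: achievable_cut net ach.
Qed.
(** * Random linear codes *)

(** All edges draw from one additive group, whatever their tail: codes then form a finite function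
    space, and fibres of [edge_out] are compared by translation. *)
Definition edge_code (F : fieldType) (E : finType) (k l : nat) :=
  ('M[F]_(k, l) * {ffun E -> 'M[F]_l})%type.

(* The symbol that an edge with code a puts out, when the root r holds the
   message x and the other edges carry y; the row dimension p is 1 for a single
   message and k for the global transfer matrices. *)
Definition edge_out (F : fieldType) (V E : finType) (tl hd : E -> V) (r : V)
    (k l p : nat) (x : 'M[F]_(p, k)) (y : E -> 'M[F]_(p, l)) (e : E)
    (a : edge_code F E k l) : 'M[F]_(p, l) :=
  if tl e == r then (x *m a.1)%R
  else (\sum_(e' | hd e' == tl e) y e' *m a.2 e')%R.

Definition active (F : fieldType) (V E : finType) (hd : E -> V) (r : V) (l : nat)
    (y : E -> 'rV[F]_l) : {set V} :=
  [set v | (v == r) || [exists e, (hd e == v) && (y e != 0%R)]].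

Lemma edge_outD (F : fieldType) (V E : finType) (tl hd : E -> V) (r : V)
    (k l p : nat) (x : 'M[F]_(p, k)) (y : E -> 'M[F]_(p, l)) (e : E)
    (a b : edge_code F E k l) :
  (edge_out tl hd r x y e (a + b)%R =
   edge_out tl hd r x y e a + edge_out tl hd r x y e b)%R.
Proof.
rewrite /edge_out; case: ifP => _; first by rewrite mulmxDr.
by rewrite -big_split; apply: eq_bigr => e' _; rewrite ffunE mulmxDr.
Qed.

Lemma mulmx_edge_out (F : fieldType) (V E : finType) (tl hd : E -> V) (r : V)
    (k l p q : nat) (z : 'M[F]_(q, p)) (x : 'M[F]_(p, k)) (y : E -> 'M[F]_(p, l))
    (e : E) (a : edge_code F E k l) :
  (z *m edge_out tl hd r x y e a =
   edge_out tl hd r (z *m x) (fun e' => z *m y e') e a)%R.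
Proof.
rewrite /edge_out; case: ifP => _; first by rewrite mulmxA.
by rewrite mulmx_sumr; apply: eq_bigr => e' _; rewrite mulmxA.
Qed.

Lemma rV_mulmx_surj (F : fieldType) (k l : nat) (u : 'rV[F]_k) (z : 'rV[F]_l) :
  u != 0%R -> exists A, (u *m A = z)%R.
Proof.
move=> u_neq0; exists (pinvmx u *m z)%R.
by rewrite mulmxA mulmxVp ?mul1mx // /row_free rank_rV u_neq0.
Qed.

Lemma edge_out_surj (F : fieldType) (V E : finType) (tl hd : E -> V) (r : V)
    (k l : nat) (x : 'rV[F]_k) (y : E -> 'rV[F]_l) (e : E) (z : 'rV[F]_l) :
  x != 0%R -> tl e \in active hd r y ->
  exists a : edge_code F E k l, edge_out tl hd r x y e a = z.
Proof.
move=> x_neq0; rewrite inE /edge_out.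
have [_ _ | _ /= /existsP[e0 /andP[hd_e0 y_neq0]]] := eqVneq (tl e) r.
  have [A <-] := rV_mulmx_surj z x_neq0.
  by exists (A, [ffun=> 0%R]).
have [A <-] := rV_mulmx_surj z y_neq0.
exists (0%R, [ffun e' => if e' == e0 then A else 0%R]).
rewrite (bigD1 e0) //= ffunE eqxx big1 ?addr0 // => e' /andP[_ /negPf e'e0].
by rewrite ffunE e'e0 mulmx0.
Qed.

Lemma edge_out_inactive (F : fieldType) (V E : finType) (tl hd : E -> V) (r : V)
    (k l : nat) (x : 'rV[F]_k) (y : E -> 'rV[F]_l) (e : E) (a : edge_code F E k l) :
  tl e \notin active hd r y -> edge_out tl hd r x y e a = 0%R.
Proof.
rewrite inE negb_or /edge_out => /andP[/negPf-> /existsPn yN].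
apply: big1 => e' hd_e'; have := yN e'.
by rewrite hd_e' /= negbK => /eqP->; rewrite mul0mx.
Qed.

(** The output is additive and onto as a function of the code, so a translate of any fibre lies in
    any other, and the fibres over all of F^l partition the codes. *)
Lemma card_edge_out_fiber (F : finFieldType) (V E : finType) (tl hd : E -> V)
    (r : V) (k l : nat) (x : 'rV[F]_k) (y : E -> 'rV[F]_l) (e : E) (z : 'rV[F]_l) :
  x != 0%R -> tl e \in active hd r y ->
  #|[pred a : edge_code F E k l | z == edge_out tl hd r x y e a]| * #|F| ^ l
    <= #|{: edge_code F E k l}|.
Proof.
move=> x_neq0 tl_act; set A := [pred a | _].
have fib_le w : #|A| <= #|[set a | edge_out tl hd r x y e a == w]|.
  have [b bP] := edge_out_surj (k := k) (w - z)%R x_neq0 tl_act.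
  rewrite -(card_imset A (addIr b)); apply: subset_leq_card.
  apply/subsetP=> _ /imsetP[a /eqP zE ->].
  by rewrite inE edge_outD bP -zE addrC subrK.
have -> : #|F| ^ l = #|'rV[F]_l| by rewrite card_mx mul1n.
rewrite mulnC -sum_nat_const (eq_bigl xpredT) //.
apply: (@leq_trans (\sum_w #|[set a | edge_out tl hd r x y e a == w]|)).
  exact: leq_sum.
rewrite -[X in _ <= X]sum1_card (partition_big (edge_out tl hd r x y e) xpredT) //=.
by apply: leq_sum => w _; rewrite sum1dep_card cardsE.
Qed.

Definition out_cut (V E : finType) (tl hd : E -> V) (U : {set V}) : {set E} :=
  [set e | (tl e \in U) && (hd e \notin U)].

Lemma out_cut_separates (V E : finType) (tl hd : E -> V) (U : {set V}) (u v : V) :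
  u \in U -> v \notin U -> separates tl hd (out_cut tl hd U) u v.
Proof.
move=> uU; apply: contra => /connectP[p].
elim: p u uU => [|w p IHp] u uU /=; first by move=> _ ->.
case/andP=> /existsP[e /and3P[eNC /eqP tl_e /eqP hd_e]]; apply: IHp.
by move: eNC; rewrite inE tl_e hd_e uU negbK.
Qed.

(* Consistency of y with a code is a condition on each edge separately, so the
   number of codes producing y is a product of fibre sizes. *)
Lemma card_codes_active (F : finFieldType) (V E : finType) (tl hd : E -> V)
    (r : V) (k l : nat) (x : 'rV[F]_k) (U : {set V}) :
  x != 0%R ->
  #|[set A : {ffun E -> edge_code F E k l} |
      [exists y : {ffun E -> 'rV[F]_l},
        [forall e, y e == edge_out tl hd r x y e (A e)]
        && (active hd r y == U)]]| * (#|F| ^ l) ^ #|out_cut tl hd U|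
  <= #|{: edge_code F E k l}| ^ #|E|.
Proof.
move=> x_neq0; set Bad := [set A | _]; set q := #|F| ^ l; set L := #|{: _}|.
pose S := [set e | tl e \in U]; pose S' := S :&: [set e | hd e \in U].
have q_gt0 : 0 < q by rewrite expn_gt0 (ltnW (finNzRing_gt1 F)).
have cardS : #|S| = #|S'| + #|out_cut tl hd U|.
  rewrite -(cardsID [set e | hd e \in U] S); congr (_ + #|pred_of_set _|).
  by apply/setP=> e; rewrite !inE andbC.
pose Y := [set y : {ffun E -> 'rV[F]_l} |
  (active hd r y == U) && [forall e, (tl e \notin U) ==> (y e == 0%R)]].
pose fib (y : {ffun E -> 'rV[F]_l}) e :=
  [pred a : edge_code F E k l | y e == edge_out tl hd r x y e a].
have fib_le y : y \in Y -> #|family (fib y)| * q ^ #|S| <= L ^ #|E|.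
  rewrite inE => /andP[/eqP actU _].
  rewrite card_family foldrE big_map big_enum /= -prod_nat_const.
  rewrite -(prod_nat_const E) [X in _ * X]big_mkcond -big_split /=.
  rewrite [X in _ <= X](eq_bigl xpredT) //.
  apply: leq_prod => e _; case: ifP => [|_]; last by rewrite muln1 max_card.
  by rewrite inE -actU; apply: card_edge_out_fiber.
(* An edge with tail or head outside U carries 0, so y is supported on the edges inside U. *)
have Y_le : #|Y| <= q ^ #|S'|.
  have -> : q = #|'rV[F]_l| by rewrite card_mx mul1n.
  rewrite -(card_pffun_on (0%R : 'rV[F]_l)).
  apply: subset_leq_card; apply/subsetP=> y; rewrite inE => /andP[/eqP actU /forallP y0].
  apply/pffun_onP; split=> //; apply/supportP=> e; rewrite !inE negb_and.
  case/orP=> [tlN | hdN]; first by have := y0 e; rewrite tlN => /eqP.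
  apply/eqP; apply: contraNT hdN => y_neq0; rewrite -actU inE.
  by apply/orP; right; apply/existsP; exists e; rewrite eqxx.
have Bad_le : #|Bad| <= \sum_(y in Y) #|family (fib y)|.
  apply: leq_trans (_ : _ <= \sum_(y in Y) #|[set A in family (fib y)]|) _.
    apply: leq_trans (card_bigcup_leq _ _); apply: subset_leq_card.
    apply/subsetP=> A; rewrite inE => /existsP[y /andP[/forallP yA actU]].
    apply/bigcupP; exists y; last by rewrite inE; apply/familyP.
    rewrite inE actU; apply/forallP=> e; apply/implyP=> tlN.
    by rewrite (eqP (yA e)) edge_out_inactive // (eqP actU).
  by apply: leq_sum => y _; rewrite cardsE.
(* The factor q^|S'| completes the cut to S, where [fib_le] applies to each y; it cancels against
   the bound on |Y|. *)
have qS_gt0 : 0 < q ^ #|S'| by rewrite expn_gt0 q_gt0.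
rewrite -(leq_pmul2l qS_gt0).
rewrite mulnCA -expnD -cardS; apply: leq_trans (leq_mul Bad_le (leqnn _)) _.
rewrite big_distrl; apply: (@leq_trans (\sum_(y in Y) L ^ #|E|)).
  exact: leq_sum.
by rewrite sum_nat_const leq_mul2r Y_le orbT.
Qed.

(** The blocks placed side by side, with 0 outside P, form a matrix with independent rows; the row
    blocks of its right inverse are the Q e. *)
Lemma mulmx_left_inverse_sum (F : fieldType) (E : finType) (P : pred E) (k l : nat)
    (G : E -> 'M[F]_(k, l)) :
  (forall x : 'rV[F]_k, (forall e, P e -> x *m G e = 0)%R -> x = 0%R) ->
  exists Q : E -> 'M[F]_(l, k), (\sum_(e | P e) G e *m Q e = 1%:M)%R.
Proof.
move=> Ginj; pose H e := if P e then G e else 0%R.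
pose M := (\mxrow_(a < #|E|) H (enum_val a))%R.
have M_free : row_free M.
  apply: inj_row_free => x; rewrite mul_mxrow -[RHS](mxrow0 (q_ := fun=> l)) => xH.
  apply: Ginj => e Pe; have /eq_mxrowP/(_ (enum_rank e)) := xH.
  by rewrite enum_rankK /H Pe.
exists (fun e => submxcol (pinvmx M) (enum_rank e)).
rewrite -(mulmxVp M_free) -[in RHS](submxcolK (pinvmx M)) mul_mxrow_mxcol.
rewrite (reindex _ (onW_bij _ (enum_val_bij E))) big_mkcond.
apply: eq_bigr => a _; rewrite enum_valK /H.
by case: ifP => // _; rewrite mul0mx.
Qed.

(** B holds the local coding matrices and G the global transfer matrices. The receivers are an
    arbitrary set T, so that both terminals and, after reversal, sources can take this role. *)
Lemma multicast_code (F : finFieldType) (V E : finType) (tl hd : E -> V) (r : V)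
    (T : pred V) (k l h : nat) :
  acyclic tl hd ->
  (forall v, T v -> v != r /\ h <= mincut tl hd r v) ->
  k + #|V| < l * h ->
  exists (B : E -> E -> 'M[F]_l) (G : E -> 'M[F]_(k, l)),
    (forall e, tl e != r -> G e = \sum_(e' | hd e' == tl e) G e' *m B e e')%R /\
    (forall v, T v -> exists Q : E -> 'M[F]_(l, k),
       (\sum_(e | hd e == v) G e *m Q e = 1%:M)%R).
Proof.
move=> acy Tcut lt_kh; set code := edge_code F E k l.
have [N NP] := acyclic_fixpoint (fun=> 0%R : 'M[F]_(k, l)) acy.
pose upd (A : {ffun E -> code}) y e := edge_out tl hd r 1%:M%R y e (A e).
pose G A := iter N (upd A) (fun=> 0%R).
have GE A e : G A e = upd A (G A) e.
  apply: NP => {}e y y' eqy; rewrite /upd /edge_out; case: ifP => // _.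
  by apply: eq_bigr => e' /eqP/eqy->.
pose Bad (p : 'rV[F]_k * {set V}) := [set A : {ffun E -> code} |
  [exists y : {ffun E -> 'rV[F]_l},
    [forall e, y e == edge_out tl hd r p.1 y e (A e)] && (active hd r y == p.2)]].
pose I (p : 'rV[F]_k * {set V}) :=
  [&& p.1 != 0%R, r \in p.2 & [exists (v | T v), v \notin p.2]].
have q_gt1 := finNzRing_gt1 F; have q_gt0 := ltnW q_gt1.
have L_gt0 : 0 < #|{: code}| ^ #|E|.
  by rewrite expn_gt0; apply/orP; left; apply/card_gt0P; exists 0%R.
have Bad_le p : I p -> #|Bad p| * #|F| ^ (l * h) <= #|{: code}| ^ #|E|.
  case: p => x U /and3P[/= x_neq0 rU /existsP[v /andP[Tv vNU]]].
  have := card_codes_active tl hd r l U x_neq0; apply: leq_trans.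
  rewrite leq_mul2l expnM leq_pexp2l ?expn_gt0 ?q_gt0 ?orbT //.
  have [_ h_le] := Tcut v Tv; apply: leq_trans h_le _.
  exact: (bigminn_leq (fun C : {set E} => #|C|) _ (out_cut_separates tl hd rU vNU)).
have [A A_good] : exists A, A \notin \bigcup_(p | I p) Bad p.
  apply/existsP; rewrite -negb_forall; apply/negP=> /forallP A_bad.
  have : #|{: code}| ^ #|E| * #|F| ^ (l * h) <= #|F| ^ (k + #|V|) * #|{: code}| ^ #|E|.
    have -> : #|{: code}| ^ #|E| * #|F| ^ (l * h) =
              #|\bigcup_(p | I p) Bad p| * #|F| ^ (l * h).
      congr (_ * _); rewrite -card_ffun -cardsT.
      by congr #|pred_of_set _|; apply/setP=> A; rewrite A_bad inE.
    apply: leq_trans (leq_mul (card_bigcup_leq _ _) (leqnn _)) _.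
    rewrite big_distrl.
    apply: (@leq_trans (\sum_(p | I p) #|{: code}| ^ #|E|)); first exact: leq_sum.
    rewrite sum_nat_const leq_mul2r; apply/orP; right.
    (* There are q^k messages and 2^|V| <= q^|V| candidate active sets. *)
    apply: leq_trans (max_card _) _; rewrite card_prod card_mx mul1n expnD.
    rewrite leq_mul2l; apply/orP; right.
    rewrite -cardsT -powersetT card_powerset cardsT leq_exp2r //.
    by apply/card_gt0P; exists r.
  rewrite mulnC leq_pmul2r // leq_exp2l //.
  by rewrite leqNgt lt_kh.
exists (fun e e' => (A e).2 e'), (G A); split=> [e /negPf tl_e | v Tv].
  by rewrite GE /upd /edge_out tl_e.
(* A nonzero x invisible at v would give an active set missing v, putting A in a bad event. *)
apply: mulmx_left_inverse_sum => x xG0; apply/eqP; apply: contraNT A_good => x_neq0.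
pose y := [ffun e => (x *m G A e)%R].
apply/bigcupP; exists (x, active hd r y).
  rewrite /I /= x_neq0 inE eqxx /=; apply/existsP; exists v; rewrite Tv inE.
  have [/negPf-> _] := Tcut v Tv; apply/existsPn=> e; rewrite negb_and negbK.
  by have [/xG0 xGe | //] := boolP (hd e == v); rewrite ffunE xGe eqxx orbT.
rewrite inE; apply/existsP; exists y; rewrite eqxx andbT; apply/forallP=> e.
rewrite ffunE GE /upd mulmx_edge_out mulmx1 /edge_out.
by case: ifP => // _; apply/eqP; apply: eq_bigr => e' _; rewrite ffunE.
Qed.

(** * Achievability *)

Lemma lin_fun_sum (F : fieldType) (E : finType) (P : pred E) (l p : nat)
    (M : E -> 'M[F]_(l, p)) :
  lin_fun (fun y : E -> 'rV[F]_l => \sum_(e | P e) y e *m M e)%R.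
Proof.
move=> a y y'; rewrite scaler_sumr -big_split; apply: eq_bigr => e _ /=.
by rewrite mulmxDl scalemxAl.
Qed.

Lemma local_at_sum (V E : finType) (hd : E -> V) (F : fieldType) (l p : nat)
    (v : V) (M : E -> 'M[F]_(l, p)) :
  local_at hd v (fun y : E -> 'rV[F]_l => \sum_(e | hd e == v) y e *m M e)%R.
Proof. by move=> y y' eqy; apply: eq_bigr => e /eqP/eqy->. Qed.

Lemma min_mincut_leq (V E : finType) (tl hd : E -> V) (m n : nat)
    (s : 'I_m -> V) (t : 'I_n -> V) (i : 'I_m) (j : 'I_n) :
  min_mincut tl hd s t <= mincut tl hd (s i) (t j).
Proof.
exact: (bigminn_leq (fun p : 'I_m * 'I_n => mincut tl hd (s p.1) (t p.2))
  _ (isT : xpredT (i, j))).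
Qed.

Lemma lin_achievable_single_source (F : finFieldType) (V E : finType)
    (tl hd : E -> V) (n : nat) (s : 'I_1 -> V) (t : 'I_n -> V) (k l : nat) :
  sum_network tl hd s t -> k + #|V| < l * min_mincut tl hd s t ->
  lin_achievable tl hd s t F k l.
Proof.
move=> [[acy _ _] [_ _ sNt _]] lt_kh.
have l_gt0 : 0 < l by case: l lt_kh.
pose T v := [exists j, t j == v].
have Tcut v : T v -> v != s ord0 /\
    min_mincut tl hd s t <= mincut tl hd (s ord0) v.
  case/existsP=> j /eqP <-; split; last exact: min_mincut_leq.
  by apply/eqP=> /esym; apply: sNt.
have [B [G [GE GQ]]] := multicast_code F acy Tcut lt_kh.
have /fin_all_exists[Q QP] j : exists Qj : E -> 'M[F]_(l, k),
    (\sum_(e | hd e == t j) G e *m Qj e = 1%:M)%R.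
  by apply: GQ; apply/existsP; exists j.
split=> //; exists (fun e x => x *m G e)%R.
exists (fun e y => \sum_(e' | hd e' == tl e) y e' *m B e e')%R.
exists (fun j y => \sum_(e | hd e == t j) y e *m Q j e)%R.
split=> [|e a x x'|e|j]; try exact: lin_fun_sum; last by rewrite mulmxDl scalemxAl.
split=> [e|j|X y [ysrc yint] j]; try exact: local_at_sum.
have [rk rkP] := acyclic_rank acy.
(* With one source the required sum is the message itself, which each edge carries through its
   transfer matrix. *)
have yE N e : rk (tl e) < N -> y e = (X ord0 *m G e)%R.
  elim: N e => // N IHN e lt_eN.
  have [tl_e | tl_e] := eqVneq (tl e) (s ord0); first exact: ysrc.
  rewrite yint => [|i]; last by rewrite ord1; apply/eqP.
  rewrite GE // mulmx_sumr; apply: eq_bigr => e' /eqP e'e.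
  rewrite mulmxA IHN // -ltnS; apply: leq_trans lt_eN.
  by rewrite ltnS -e'e.
rewrite big_ord1 -[RHS]mulmx1 -(QP j) mulmx_sumr.
by apply: eq_bigr => e _; rewrite mulmxA (yE _ e (ltnSn _)).
Qed.

(* Transposing a multicast code of the reversed network exchanges encoders and
   decoders; summing y e *m (G e)^T over all edges telescopes along the network. *)
Lemma lin_achievable_single_terminal (F : finFieldType) (V E : finType)
    (tl hd : E -> V) (m : nat) (s : 'I_m -> V) (t : 'I_1 -> V) (k l : nat) :
  sum_network tl hd s t -> k + #|V| < l * min_mincut tl hd s t ->
  lin_achievable tl hd s t F k l.
Proof.
move=> [[acy _ _] [s_inj _ sNt hdNs]] lt_kh.
have l_gt0 : 0 < l by case: l lt_kh.
pose r := t ord0; pose T v := [exists i, s i == v].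
have Tcut v : T v -> v != r /\ min_mincut tl hd s t <= mincut hd tl r v.
  case/existsP=> i /eqP <-; split; last by rewrite mincut_rev min_mincut_leq.
  exact/eqP/sNt.
have [B [G [GE GQ]]] := multicast_code F (acyclic_rev acy) Tcut lt_kh.
have /fin_all_exists[Q QP] i : exists Qi : E -> 'M[F]_(l, k),
    (\sum_(e | tl e == s i) G e *m Qi e = 1%:M)%R.
  by apply: GQ; apply/existsP; exists i.
pose srcQ e : 'M[F]_(k, l) :=
  if [pick i | tl e == s i] is Some i then (Q i e)^T%R else 0%R.
have srcQE i e : tl e = s i -> srcQ e = (Q i e)^T%R.
  move=> tl_e; rewrite /srcQ; case: pickP => [i' /eqP | /(_ i)].
    by rewrite tl_e => /s_inj->.
  by rewrite tl_e eqxx.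
(* The recursion [GE] covers only edges whose head is not r, so edges leaving r are made to carry
   0. *)
pose Bt e e' : 'M[F]_l := if tl e == r then 0%R else (B e' e)^T%R.
split=> //; exists (fun e x => x *m srcQ e)%R.
exists (fun e y => \sum_(e' | hd e' == tl e) y e' *m Bt e e')%R.
exists (fun j y => \sum_(e | hd e == t j) y e *m (G e)^T)%R.
split=> [|e a x x'|e|j]; try exact: lin_fun_sum; last by rewrite mulmxDl scalemxAl.
split=> [e|j|X y [ysrc yint] j]; try exact: local_at_sum.
rewrite ord1 -/r {j}.
pose src e := [exists i, tl e == s i].
have yintE e : ~~ src e -> (y e = \sum_(e' | hd e' == tl e) y e' *m Bt e e')%R.
  by move=> /existsPn tlN; apply: yint => i; apply/eqP.
(* Expanding G by its recursion and exchanging the sums turns the transposed B into the encoding of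
   the next edge. *)
have inner : (\sum_(e | hd e != r) y e *m (G e)^T =
              \sum_(e | ~~ src e) y e *m (G e)^T)%R.
  transitivity (\sum_(e' | hd e' != r) \sum_(e | tl e == hd e')
      y e' *m (B e' e)^T *m (G e)^T)%R.
    apply: eq_bigr => e' hd_e'; rewrite GE // linear_sum mulmx_sumr /=.
    by apply: eq_bigr => e _; rewrite trmx_mul mulmxA.
  rewrite (exchange_big_dep (fun e => ~~ src e)) /=; last first.
    move=> e' e _ /eqP e'e; apply/existsPn=> i; rewrite e'e.
    exact/eqP/hdNs.
  apply: eq_bigr => e /yintE->; rewrite mulmx_suml /Bt.
  have [tl_e | tl_e] := eqVneq (tl e) r.
    rewrite !big1 // => e' => [_ | /andP[/negPf]]; first by rewrite mulmx0 mul0mx.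
    by rewrite tl_e eq_sym => ->.
  apply: eq_bigl => e'; rewrite [tl e == _]eq_sym.
  by have [-> | _] := eqVneq (hd e') (tl e); rewrite ?tl_e ?andbF.
(* Each side is the sum over all edges minus a side of [inner]: what enters r equals what leaves the
   sources. *)
have -> : (\sum_(e | hd e == r) y e *m (G e)^T =
           \sum_(e | src e) y e *m (G e)^T)%R.
  apply: (addIr (\sum_(e | hd e != r) y e *m (G e)^T)%R).
  transitivity (\sum_e y e *m (G e)^T)%R.
    by rewrite [RHS](bigID (fun e => hd e == r)).
  by rewrite inner [LHS](bigID src).
transitivity (\sum_(i < m) \sum_(e | tl e == s i) y e *m (G e)^T)%R; last first.
  apply: eq_bigr => i _; rewrite -[RHS]mulmx1 -trmx1 -(QP i) linear_sum mulmx_sumr /=.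
  apply: eq_bigr => e /eqP tl_e.
  by rewrite (ysrc i) // (srcQE i) // trmx_mul mulmxA.
rewrite (exchange_big_dep src) /=; last by move=> i e _ tl_e; apply/existsP; exists i.
apply: eq_bigr => e /existsP[i /eqP tl_e].
rewrite (eq_bigl (pred1 i)) ?big_pred1_eq // => i' /=.
by rewrite tl_e (inj_eq s_inj) eq_sym.
Qed.

(** * From codes with additive slack to the capacity *)

Lemma lin_achievable_rate0 (F : fieldType) (V E : finType) (tl hd : E -> V)
    (m n : nat) (s : 'I_m -> V) (t : 'I_n -> V) (l : nat) :
  0 < l -> lin_achievable tl hd s t F 0 l.
Proof.
move=> l_gt0; split=> //; exists (fun _ _ => 0%R), (fun _ _ => 0%R), (fun _ _ => 0%R).
split=> [|e a x x'|e a y y'|j a y y']; try by rewrite scaler0 addr0.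
split=> // X y _ j; apply/esym; exact: thinmx0.
Qed.

(** A slack c that does not depend on l costs the rate only about c / l, which vanishes for long
    blocks. *)
Lemma capacity_of_slack (P : nat -> nat -> Prop) (h c : nat) :
  (forall k l, P k l -> 0 < l /\ k <= l * h) ->
  (forall l, 0 < l -> P 0 l) ->
  (forall k l, k + c < l * h -> P k l) ->
  is_capacity P h%:R%R.
Proof.
move=> Ple P0 Pslack; split=> [k l /Ple[l_gt0 le_kl] | r lt_rh].
  by rewrite ler_pdivrMr ?ltr0n // mulrC -natrM ler_nat.
have d_gt0 : (0 < h%:R - r)%R by rewrite subr_gt0.
pose l := (Num.bound (c.+1%:R / (h%:R - r)%R)).+1.
have l_gt0 : 0 < l by [].
have l_big : (c.+1%:R < l%:R * (h%:R - r))%R.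
  rewrite -ltr_pdivrMr //; apply: lt_le_trans (archi_boundP _) _.
    by rewrite divr_ge0 ?ler0n // ltW.
  by rewrite ler_nat leqnSn.
(* The successor makes the slack inequality strict; if the truncated difference is 0, the rate 0
   hypothesis takes over. *)
exists (l * h - c.+1), l; split.
  have [le_lc | lt_cl] := leqP (l * h) c.+1.
    by rewrite (eqP le_lc); apply: P0.
  by apply: Pslack; rewrite -ltnS -addnS subnK // ltnW.
rewrite ltr_pdivlMr ?ltr0n // mulrC.
apply: (@lt_le_trans _ _ (l%:R * h%:R - c.+1%:R)%R).
  by rewrite ltrBrDr -ltrBrDl -mulrBr.
by rewrite lerBlDr -natrM -natrD ler_nat addnC -leq_subLR.
Qed.

Theorem mainTheorem2 (F : finFieldType) (V E : finType) (tl hd : E -> V)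
    (m n : nat) (s : 'I_m -> V) (t : 'I_n -> V) :
  sum_network tl hd s t -> (m = 1 \/ n = 1) ->
  is_capacity (achievable tl hd s t F) (min_mincut tl hd s t)%:R /\
  is_capacity (lin_achievable tl hd s t F) (min_mincut tl hd s t)%:R.
Proof.
move=> net mn1.
have lin_ach k l : lin_achievable tl hd s t F k l -> achievable tl hd s t F k l.
  by case=> l_gt0 [fsrc [fint [dec [sol _ _ _]]]]; split=> //; exists fsrc, fint, dec.
have lin0 l : 0 < l -> lin_achievable tl hd s t F 0 l.
  exact: lin_achievable_rate0.
have lin_slack k l : k + #|V| < l * min_mincut tl hd s t ->
    lin_achievable tl hd s t F k l.
  case: mn1 => eq1; subst.
    exact: lin_achievable_single_source.
  exact: lin_achievable_single_terminal.
have ach_le k l : achievable tl hd s t F k l -> 0 < l /\ k <= l * min_mincut tl hd s t.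
  by move=> ach; split; [case: ach | apply: achievable_min_mincut ach].
(* The slack [#|V|] pays for the union bound over sets of vertices. *)
split; apply: (@capacity_of_slack _ _ #|V|) => k.
- exact: ach_le.
- by move/lin0/lin_ach.
- by move=> l /lin_slack/lin_ach.
- by move=> l /lin_ach/ach_le.
- exact: lin0.
- exact: lin_slack.
Qed.
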